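(* Let $\mathcal{C}$ be an ideal, minimum-transversal-covered clutter on a finite set $E$. Then $\mathrm{I}(\tilde{\mathcal{C}})$ is an integral polytope and $\mathrm{I}(\mathcal{C})=\mathrm{I}(\tilde{\mathcal{C}})$. The extreme points of $\mathrm{I}(\mathcal{C})$ are exactly the incidence vectors of the hyperedges of $\tilde{\mathcal{C}}$.
   Context: A clutter on $E$ is a family of subsets none containing another (members: hyperedges). A transversal is an inclusion-minimal set meeting all hyperedges; $\mathrm{b}(\mathcal{C})$ the set of transversals, $\mathrm{bn}(\mathcal{C})$ the minimum transversal size, $\mathrm{minb}(\mathcal{C})$ the minimum-size transversals. $\mathcal{C}$ is minimum-transversal-covered if $\bigcup\mathrm{minb}(\mathcal{C})=E$. $\mathcal{C}$ is ideal if $\{x\in\mathbb{R}^E:x\ge0,\ \langle x,1_H\rangle\ge1\ \forall H\in\mathcal{C}\}$ is an integral polyhedron. $\tilde{\mathcal{C}}=\{H\in\mathcal{C}:|H\cap B|=1\ \forall B\in\mathrm{minb}(\mathcal{C})\}$. $\mathrm{I}(\mathcal{C})=\{x\in\mathbb{R}^E:\langle x,1_D\rangle=1\ \forall D\in\mathrm{minb}(\mathcal{C}),\ \langle x,1_D\rangle\ge1\ \forall D\in\mathrm{b}(\mathcal{C}),\ x\ge0\}$. *)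

(* Defs.v *)
From mathcomp Require Import all_boot all_order all_algebra.
From mathcomp Require Import boolp classical_sets reals convex.

Set Implicit Arguments.
Unset Strict Implicit.
Unset Printing Implicit Defensive.

Import Order.TTheory GRing.Theory Num.Theory.

Local Open Scope ring_scope.

Section Clutters.
Variable E : finType.
Implicit Types (C : {set {set E}}) (B H : {set E}).

Definition is_clutter C : Prop :=
  forall H1 H2, H1 \in C -> H2 \in C -> H1 \subset H2 -> H1 = H2.

Definition meets_all C B : bool := [forall H in C, B :&: H != finset.set0].

Definition transversals C : {set {set E}} :=
  [set B : {set E} | minset (meets_all C) B].

(* Every transversal has at most #|E| elements, so the default value #|E| only
   matters when there is no transversal at all, i.e. when C contains the empty
   set; minb C is then empty anyway. *)
Definition bn C : nat := \big[minn/#|E|]_(B in transversals C) #|B|.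

Definition minb C : {set {set E}} := [set B in transversals C | #|B| == bn C].

Definition minimum_transversal_covered C : Prop :=
  finset.cover (minb C) = [set: E]%SET.

Definition tilde C : {set {set E}} :=
  [set H in C | [forall B in minb C, #|H :&: B| == 1%N]].

End Clutters.

Section Polyhedra.
Variables (R : realType) (E : finType).

(* The codomain is the regular module R^o because {ffun E -> V} is an lmodType
   over R only when V is one. *)
Local Notation vec := {ffun E -> R^o}.

Local Open Scope classical_set_scope.

Definition dotp (x y : vec) : R := \sum_(e : E) (x e : R) * y e.

Definition incidence (A : {set E}) : vec := [ffun e => (e \in A)%:R].

Definition nonneg (x : vec) : Prop := forall e, 0 <= (x e : R).

Definition is_polyhedron (P : set vec) : Prop :=
  exists s : seq (vec * R),
    P = [set x | forall ab, ab \in s -> ab.2 <= dotp x ab.1].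

Definition integral_points (P : set vec) : set vec :=
  [set x | P x /\ forall e, (x e : R) \is a Num.int].

Definition convex_hull (A : set vec) : set vec := smallest (@convex_set R vec) A.

Definition integral_polyhedron (P : set vec) : Prop :=
  is_polyhedron P /\ P = convex_hull (integral_points P).

Definition is_bounded (P : set vec) : Prop :=
  exists M : R, forall x, P x -> forall e, `|x e : R| <= M.

Definition integral_polytope (P : set vec) : Prop :=
  integral_polyhedron P /\ is_bounded P.

Definition extreme_points (P : set vec) : set vec :=
  [set x | P x /\
    forall y z (t : R), P y -> P z -> 0 < t < 1 ->
      x = t *: y + (1 - t) *: z -> y = x /\ z = x].

Definition ideal (C : {set {set E}}) : Prop :=
  integral_polyhedron
    [set x : vec | nonneg x /\ forall H, H \in C -> 1 <= dotp x (incidence H)].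

Definition polyI (C : {set {set E}}) : set vec :=
  [set x : vec |
    [/\ forall D, D \in minb C -> dotp x (incidence D) = 1,
        forall D, D \in transversals C -> 1 <= dotp x (incidence D)
      & nonneg x]].

End Polyhedra.

Arguments incidence R {E} A.
Arguments ideal R {E} C.
Arguments polyI R {E} C.

(* Main.v *)
(* By Farkas' lemma and the integrality of {w >= 0 : <w, 1_H> >= 1}, every x in
   I(C) dominates a convex combination of vectors 1_H with H in C. Tightness on
   the minimum transversals, which cover E, turns domination into equality and
   confines the combination to tilde C, so I(C) = conv {1_H : H in tilde C}.
   With k = bn C, the vector 1_E / k belongs to I(C), and writing it as such a
   combination shows that a set meeting all of tilde C has at least k elements.
   Hence minb C is contained in minb (tilde C), and since 1_E / k even lies in
   the relative interior of I(C), every H in tilde C meets every member of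
   minb (tilde C) exactly once. So I(tilde C) contains the same vectors 1_H,
   and I(C) = I(tilde C). *)
Require Import Defs.
From mathcomp Require Import all_boot all_order all_algebra.
From mathcomp Require Import boolp classical_sets reals.
From mathcomp Require Import interval_inference convex ring lra.

Import Order.TTheory GRing.Theory Num.Theory.

Set Implicit Arguments.
Unset Strict Implicit.
Unset Printing Implicit Defensive.

Local Open Scope classical_set_scope.
Local Open Scope ring_scope.

(** * Convex combinations and Farkas' lemma *)

Lemma convex_setP (R : realFieldType) (V : lmodType R) (A : set V) :
  @convex_set R V A <->
  forall x y (t : R), 0 < t < 1 -> A x -> A y -> A (t *: x + (1 - t) *: y).
Proof.
rewrite convex_setW; split => [cA x y t /andP[t0 t1] Ax Ay|cA x y /set_mem Ax /set_mem Ay k k0 k1].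
  have := cA x y (mem_set Ax) (mem_set Ay) (Itv01 (ltW t0) (ltW t1)) t0 t1.
  by move/set_mem.
by apply/mem_set/cA => //; rewrite k0.
Qed.

Lemma convex_sum (R : realFieldType) (V : lmodType R) (A : set V)
    (I : finType) (P : pred I) (l : I -> R) (v : I -> V) :
  @convex_set R V A -> (forall i, P i -> 0 <= l i) -> (forall i, P i -> A (v i)) ->
  \sum_(i | P i) l i = 1 -> A (\sum_(i | P i) l i *: v i).
Proof.
move=> /convex_setP cA l0 Av l1.
(* Partial weights do not sum to 1, so the invariant puts the partial sum in the cone over [A], at
   height [s]; the case [s = 0] covers empty sums and zero weights. *)
pose K (y : V) (s : R) := (s = 0 /\ y = 0) \/ 0 < s /\ exists2 a, A a & y = s *: a.
suff: K (\sum_(i | P i) l i *: v i) (\sum_(i | P i) l i).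
  rewrite l1 => -[[/eqP]|[_ [a Aa ->]]]; first by rewrite oner_eq0.
  by rewrite scale1r.
apply: (big_ind2 K) => [|y s y' s'|i Pi]; first by left.
- move=> [[-> ->]|[s0 [a Aa ->]]]; first by rewrite !add0r.
  move=> [[-> ->]|[s'0 [a' Aa' ->]]]; first by rewrite !addr0; right; split=> //; exists a.
  right; split; first exact: addr_gt0.
  have ss' : s + s' != 0 by rewrite gt_eqF// addr_gt0.
  exists ((s / (s + s')) *: a + (1 - s / (s + s')) *: a').
    apply: cA => //; rewrite divr_gt0 ?addr_gt0//=.
    by rewrite ltr_pdivrMr ?addr_gt0// mul1r ltrDl.
  by rewrite scalerDr !scalerA; congr (_ *: _ + _ *: _); field.
- have := l0 i Pi; rewrite le_eqVlt => /predU1P[<-|li0].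
    by left; rewrite scale0r.
  by right; split=> //; exists (v i) => //; exact: Av.
Qed.

(* Bartl's induction: if the first functional cannot be dropped, some [x0]
   witnesses this, and projecting along [x0] onto its kernel reduces to the
   remaining ones. *)
Lemma farkas (R : realFieldType) (V : lmodType R) (I : eqType) (r : seq I)
    (a : I -> V -> R) (g : V -> R) :
  uniq r -> (forall i, scalar (a i)) -> scalar g ->
  (forall x, (forall i, i \in r -> 0 <= a i x) -> 0 <= g x) ->
  exists2 u : I -> R, forall i, 0 <= u i & forall x, g x = \sum_(i <- r) u i * a i x.
Proof.
have lin f : scalar f -> forall c (x y : V), f (c *: x + y) = c * f x + f y by [].
elim: r a g => [|i r IH] a g /=.
  move=> _ _ lg pg; exists (fun=> 0) => // x; rewrite big_nil.
  have g0 : g 0 = 0 by have := lin g lg 1 0 0; rewrite scale1r addr0; lra.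
  have : 0 <= g (-1 *: x + 0) by rewrite addr0; exact: pg.
  have : 0 <= g x by exact: pg.
  by rewrite (lin g lg) g0; lra.
move=> /andP[ir ur] la lg pg.
have sum_if u c x : \sum_(j <- i :: r) (if j == i then c else u j) * a j x
    = c * a i x + \sum_(j <- r) u j * a j x.
  rewrite big_cons eqxx; congr (_ + _); apply: eq_big_seq => j jr.
  by case: eqP => // ji; rewrite -ji jr in ir.
have [pr|/existsNP[x0 /not_implyP[ax0 /negP]]] :=
  pselect (forall x, (forall j, j \in r -> 0 <= a j x) -> 0 <= g x).
  have [u u0 gE] := IH a g ur la lg pr.
  exists (fun j => if j == i then 0 else u j) => [j|x]; first by case: ifP.
  by rewrite sum_if mul0r add0r.
rewrite -ltNge => gx0.
(* Otherwise [x0] would satisfy every constraint and violate [g x0 < 0]. *)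
have six0 : a i x0 < 0.
  rewrite ltNge; apply/negP => aix0; move: gx0; apply/negP; rewrite -leNgt.
  by apply: pg => j; rewrite inE => /predU1P[->//|]; exact: ax0.
set s := a i x0 in six0.
have s0 : s != 0 by rewrite lt_eqF.
pose proj f x := f x - f x0 / s * a i x.
have projE f x : scalar f -> proj f x = f (- (a i x / s) *: x0 + x).
  by move=> lf; rewrite lin// /proj; ring.
have lproj f : scalar f -> scalar (proj f).
  by move=> lf c x y; rewrite /proj lf (la i) /=; ring.
have [||x px|u u0 gE] := IH (fun j => proj (a j)) (proj g) ur.
- by move=> j; exact: lproj.
- exact: lproj.
- rewrite projE//; apply: pg => j; rewrite inE => /predU1P[->|jr].
    by rewrite lin// -/s mulNr divfK// addNr.
  by rewrite -projE// px.
(* Undoing the projection leaves this coefficient on [a i]. It is nonnegative, since its numerator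
   and [s] are both negative. *)
exists (fun j => if j == i then (g x0 - \sum_(j <- r) u j * a j x0) / s else u j).
  move=> j; case: ifP => // _; rewrite ler_ndivlMr// mul0r subr_le0.
  rewrite (le_trans (ltW gx0))// big_seq sumr_ge0// => k kr.
  by rewrite mulr_ge0// ax0.
move=> x; rewrite sum_if.
have := gE x; rewrite /proj => /(canRL (subrK _)) ->.
under eq_bigr do rewrite mulrBr mulrA mulrA [_ * _ / s * _]mulrC.
rewrite big_split /= sumrN -mulr_sumr -mulr_suml; by field.
Qed.

(** * Transversals and their minimum size *)

Section Clutters.
Variable E : finType.
Implicit Types (C : {set {set E}}) (B H D : {set E}).

Lemma meets_allP C B :
  reflect (forall H, H \in C -> B :&: H != finset.set0) (meets_all C B).
Proof. exact: forall_inP. Qed.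

Lemma transversals_meets_all C B : B \in transversals C -> meets_all C B.
Proof. by rewrite inE => /minsetp. Qed.

Lemma transversal_sub C B :
  meets_all C B -> exists2 T : {set E}, T \in transversals C & T \subset B.
Proof. by move=> /minset_exists[T mT TB]; exists T; rewrite // inE. Qed.

Lemma bn_le C B : B \in transversals C -> (bn C <= #|B|)%N.
Proof. by rewrite /bn -minEnat -leEnat => BC; exact: bigmin_le_cond. Qed.

(** The bound by [#|E|] is there because [#|E|] is the initial value of the minimum defining
    [bn]. *)
Lemma bn_ge C n : (n <= #|E|)%N ->
  (forall B, B \in transversals C -> n <= #|B|)%N -> (n <= bn C)%N.
Proof.
move=> nE nB; rewrite /bn; elim/big_ind: _ => // x y nx ny.
by rewrite leq_min nx.
Qed.

Lemma tilde_sub C : tilde C \subset C.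
Proof. by apply/fintype.subsetP => H; rewrite inE => /andP[]. Qed.

Lemma tilde_card C H D : H \in tilde C -> D \in minb C -> #|H :&: D| = 1%N.
Proof. by rewrite inE => /andP[_ /forall_inP HD] /HD/eqP. Qed.

End Clutters.

(** * Inner products with incidence vectors *)

Section Polyhedra.
Variables (R : realType) (E : finType).
Implicit Types (x y w : {ffun E -> R^o}) (C : {set {set E}}) (B H D : {set E}).
Local Notation "\1_ A" := (incidence R A) (at level 8, A at level 2).

Lemma dotpC x y : dotp x y = dotp y x.
Proof. by apply: eq_bigr => e _; exact: mulrC. Qed.

Lemma dotpDl c x y w : dotp (c *: x + y) w = c * dotp x w + dotp y w.
Proof.
rewrite /dotp mulr_sumr -big_split; apply: eq_bigr => e _ /=.
by rewrite !ffunE mulrDl -mulrA.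
Qed.

Lemma dotpZl c x w : dotp (c *: x) w = c * dotp x w.
Proof.
by rewrite /dotp mulr_sumr; apply: eq_bigr => e _; rewrite ffunE -mulrA.
Qed.

Lemma dotp_suml (I : finType) (P : pred I) (l : I -> R)
    (v : I -> {ffun E -> R^o}) w :
  dotp (\sum_(i | P i) l i *: v i) w = \sum_(i | P i) l i * dotp (v i) w.
Proof.
elim/big_rec2: _ => [|i s t _ IH]; last by rewrite dotpDl IH.
by apply: big1 => e _; rewrite ffunE mul0r.
Qed.

Lemma dotp_incidence x D : dotp x \1_D = \sum_(e in D) x e.
Proof.
rewrite big_mkcond; apply: eq_bigr => e _ /=; rewrite ffunE.
by case: ifP => _; rewrite ?mulr1 ?mulr0.
Qed.

Lemma dotp_incidences H D : dotp \1_H \1_D = #|H :&: D|%:R.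
Proof.
rewrite dotp_incidence -sum1_card natr_sum big_mkcond [RHS]big_mkcond.
by apply: eq_bigr => e _; rewrite inE ffunE andbC; case: (e \in D); case: (e \in H).
Qed.

Lemma nonneg_incidence H : nonneg \1_H.
Proof. by move=> e; rewrite ffunE ler0n. Qed.

(** * Consequences of idealness *)

(* Half of Lehman's theorem that the blocker of an ideal clutter is ideal. *)
Lemma ideal_dotp_ge1 C w x : ideal R C ->
  nonneg w -> (forall H, H \in C -> 1 <= dotp w \1_H) ->
  nonneg x -> (forall D, D \in transversals C -> 1 <= dotp x \1_D) ->
  1 <= dotp w x.
Proof.
move=> [_ QE] w0 wC x0 xD.
have: [set w : {ffun E -> R^o} | nonneg w /\
  forall H, H \in C -> 1 <= dotp w \1_H]%classic w by [].
(* The condition on [w] defines a convex set, so by integrality only integral [w] need be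
   checked. *)
rewrite QE; move: w {w0 wC}; apply: smallest_sub => [|w [[w0 wC] wint]].
  apply/convex_setP => u v t /andP[t0 t1] /= u1 v1.
  by rewrite dotpDl dotpZl; nra.
(* The support of [w] contains a transversal [T], and nonzero integral entries are at least 1, so
   [w] dominates the incidence vector of [T]. *)
pose B := [set e | w e != 0]%SET.
have /transversal_sub[T TC TB] : meets_all C B.
  apply/meets_allP => H HC; apply/eqP => BH; have := wC H HC.
  rewrite dotp_incidence big1 ?ler10// => e eH; apply/eqP/negPn/negP => we.
  by have := finset.in_set0 e; rewrite -BH !inE we eH.
rewrite /= (le_trans (xD T TC))// dotp_incidence big_mkcond dotpC.
apply: ler_sum => e _; case: ifPn => eT; last exact: mulr_ge0.
rewrite ler_peMr//; have := fintype.subsetP TB e eT; rewrite inE => we.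
by have := norm_intr_ge1 (wint e) we; rewrite ger0_norm.
Qed.

(* Farkas' lemma for the functionals [(w, t) |-> w e] and
   [(w, t) |-> <w, 1_H> - t]. *)
Lemma ideal_dominated C x : ideal R C ->
  nonneg x -> (forall D, D \in transversals C -> 1 <= dotp x \1_D) ->
  exists l : {set E} -> R, [/\ forall H, 0 <= l H, \sum_(H in C) l H = 1 &
    forall e, \sum_(H in C) l H * \1_H e <= x e].
Proof.
move=> idC x0 xD.
pose V := ({ffun E -> R^o} * R^o)%type.
pose P (i : E + {set E}) := if i is inr H then H \in C else true.
pose a (i : E + {set E}) (v : V) : R :=
  match i with inl e => v.1 e | inr H => dotp v.1 \1_H - v.2 end.
pose g (v : V) : R := dotp v.1 x - v.2.
have memP i : (i \in [seq i <- index_enum (E + {set E})%type | P i]) = P i.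
  by rewrite mem_filter mem_index_enum andbT.
have [||||u u0 gE] := @farkas R V _ [seq i <- index_enum (E + {set E})%type | P i] a g.
- by rewrite filter_uniq// index_enum_uniq.
- move=> [e|H] c v v' /=; first by rewrite !ffunE.
  by rewrite dotpDl mulrBr opprD addrACA.
- by move=> c v v'; rewrite /g /= dotpDl mulrBr opprD addrACA.
- move=> [w t] aw; rewrite /g /= subr_ge0.
  have w0 e : 0 <= w e by apply: (aw (inl e)); rewrite memP.
  have wH H : H \in C -> t <= dotp w \1_H.
    by move=> HC; rewrite -subr_ge0; apply: (aw (inr H)); rewrite memP.
  (* For [t > 0], rescaling by [t^-1] brings [w] into the polyhedron of the ideal clutter. *)
  have [t0|t0] := leP t 0.
    by rewrite (le_trans t0)// sumr_ge0// => e _; rewrite mulr_ge0// x0.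
  have : 1 <= dotp (t^-1 *: w) x.
    apply: (ideal_dotp_ge1 idC) => // [e|H HC].
      by rewrite ffunE mulr_ge0 ?invr_ge0 ?(ltW t0).
    by rewrite dotpZl mulrC ler_pdivlMr// mul1r wH.
  by rewrite dotpZl mulrC ler_pdivlMr// mul1r.
have {}gE v : g v = \sum_e u (inl e) * v.1 e
    + \sum_(H in C) u (inr H) * (dotp v.1 \1_H - v.2).
  by rewrite gE big_filter big_sumType.
(* Evaluating the Farkas identity at [(0, 1)] gives total weight 1; evaluating it at a unit vector
   and [t = 0] gives domination in that coordinate. *)
exists (fun H => u (inr H)); split=> [H||e]; first exact: u0.
- have dotp0 y : dotp 0 y = 0 by apply: big1 => e _; rewrite ffunE mul0r.
  have := gE (0, 1); rewrite /g /= dotp0 big1 ?add0r => [|e _]; last first.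
    by rewrite ffunE mulr0.
  under eq_bigr do rewrite dotp0 sub0r mulrN1.
  by rewrite sumrN => /oppr_inj.
- have dote y : dotp \1_[set e]%SET y = y e.
    by rewrite dotpC dotp_incidence big_set1.
  have := gE (\1_[set e]%SET, 0); rewrite /g /= dote !subr0 => ->.
  under [X in _ + X]eq_bigr do rewrite subr0 dote.
  by rewrite lerDr sumr_ge0// => f _; rewrite mulr_ge0// ffunE ler0n.
Qed.

Lemma polyI_convex_comb C x : ideal R C -> minimum_transversal_covered C ->
  polyI R C x ->
  exists l : {set E} -> R, [/\ forall H, 0 <= l H, \sum_(H in tilde C) l H = 1 &
    x = \sum_(H in tilde C) l H *: \1_H].
Proof.
move=> idC covC [xD1 xD x0].
have [l [l0 l1 lx]] := ideal_dominated idC x0 xD.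
pose r e := x e - \sum_(H in C) l H * \1_H e.
have r0 e : 0 <= r e by rewrite subr_ge0.
have lHD0 H D : H \in C -> D \in minb C -> 0 <= l H * (#|H :&: D|%:R - 1).
  move=> HC; rewrite inE => /andP[/transversals_meets_all/meets_allP/(_ H HC) DH _].
  by rewrite mulr_ge0// subr_ge0 ler1n card_gt0 finset.setIC.
(* The slack of the domination on [D] and the weighted excess of [#|H :&: D|] over 1 are both
   nonnegative and add up to 0, so both vanish term by term. *)
have tight D : D \in minb C ->
    \sum_(e in D) r e + \sum_(H in C) l H * (#|H :&: D|%:R - 1) = 0.
  move=> DC; have := xD1 D DC; rewrite dotp_incidence => xD_1.
  rewrite big_split /= sumrN xD_1 exchange_big /=.
  under [X in - X]eq_bigr do rewrite -mulr_sumr -dotp_incidence dotp_incidences.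
  under [X in _ + X]eq_bigr do rewrite mulrBr mulr1.
  by rewrite [X in _ + X]big_split /= sumrN l1; ring.
have sr0 D : 0 <= \sum_(e in D) r e by exact: sumr_ge0.
have sl0 D : D \in minb C -> 0 <= \sum_(H in C) l H * (#|H :&: D|%:R - 1).
  by move=> DC; apply: sumr_ge0 => H HC; exact: lHD0.
have req0 e : r e = 0.
  have : e \in finset.cover (minb C) by rewrite covC inE.
  move=> /bigcupP[D DC eD]; apply: (psumr_eq0P (P := mem D)) eD => //.
  by move: (tight D DC) (sr0 D) (sl0 D DC); lra.
have leq0 H : H \in C -> H \notin tilde C -> l H = 0.
  rewrite inE => HC; rewrite HC /= => /forall_inPn[D DC HD1].
  have : l H * (#|H :&: D|%:R - 1) = 0.
    apply: (psumr_eq0P (fun K KC => lHD0 K D KC DC) _ HC).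
    by move: (tight D DC) (sr0 D) (sl0 D DC); lra.
  by move=> /eqP; rewrite mulf_eq0 subr_eq0 pnatr_eq1 (negPf HD1) orbF => /eqP.
have tildeE (F : {set E} -> R) : (forall H, l H = 0 -> F H = 0) ->
    \sum_(H in C) F H = \sum_(H in tilde C) F H.
  move=> F0; rewrite (big_setID (tilde C)) /= [X in _ + X]big1 ?addr0.
    by rewrite (finset.setIidPr (tilde_sub C)).
  by move=> H; rewrite inE => /andP[HtC HC]; apply/F0/leq0.
exists l; split=> //; first by rewrite -tildeE.
apply/ffunP => e; have /eqP := req0 e; rewrite subr_eq0 => /eqP ->.
rewrite sum_ffunE tildeE => [|H ->]; last by rewrite mul0r.
by apply: eq_bigr => H _; rewrite [RHS]ffunE.
Qed.

(** * The polyhedron [polyI] and some of its points *)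

Lemma convex_polyI C : @convex_set R {ffun E -> R^o} (polyI R C).
Proof.
apply/convex_setP => x y t /andP[t0 t1] [xD1 xD x0] [yD1 yD y0].
split=> [D DC|D DC|e].
- by rewrite dotpDl dotpZl xD1// yD1//; ring.
- by rewrite dotpDl dotpZl; move: (xD D DC) (yD D DC); nra.
- by rewrite !ffunE; move: (x0 e) (y0 e); rewrite /GRing.scale /=; nra.
Qed.

(** Some minimum transversal contains [e], and on it the nonnegative coordinates of [x] sum to 1. *)
Lemma polyI_le1 C x e : minimum_transversal_covered C -> polyI R C x -> x e <= 1.
Proof.
move=> covC [xD1 _ x0].
have : e \in finset.cover (minb C) by rewrite covC inE.
move=> /bigcupP[D DC eD]; rewrite -(xD1 D DC) dotp_incidence (bigD1 e)//=.
by rewrite lerDl sumr_ge0.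
Qed.

Lemma is_polyhedron_polyI C : is_polyhedron (polyI R C).
Proof.
(* Minimum transversals are transversals, so each equality only needs the reverse inequality
   added. *)
exists ([seq (\1_D, 1) | D <- enum (transversals C)]
  ++ [seq (- \1_D, -1) | D <- enum (minb C)]
  ++ [seq (\1_[set e]%SET, 0) | e <- enum E]).
have dotN x D : dotp x (- \1_D) = - dotp x \1_D.
  by rewrite dotpC -scaleN1r dotpZl mulN1r dotpC.
have dote x e : dotp x \1_[set e]%SET = x e by rewrite dotp_incidence big_set1.
apply/seteqP; split=> x /=.
  move=> [xD1 xD x0] ab; rewrite !mem_cat => /or3P[] /mapP[D + ->] /=.
  - by rewrite mem_enum; exact: xD.
  - by rewrite mem_enum dotN => /xD1 ->.
  - by rewrite dote => _; exact: x0.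
move=> xs.
have xD D : D \in transversals C -> 1 <= dotp x \1_D.
  by move=> DC; apply: (xs (\1_D, 1)); rewrite mem_cat map_f// mem_enum.
split=> // [D DC|e].
  apply: le_anti; rewrite xD ?andbT; last by move: DC; rewrite inE => /andP[].
  rewrite -lerN2 -dotN; apply: (xs (- \1_D, -1)).
  by rewrite !mem_cat [X in _ || (X || _)]map_f ?orbT// mem_enum.
rewrite -dote; apply: (xs (\1_[set e]%SET, 0)).
rewrite !mem_cat; apply/orP; right; apply/orP; right.
by apply/mapP; exists e; rewrite ?mem_enum.
Qed.

(** The intersection condition replaces [H \in tilde C] so that the lemma serves both for [C] and
    with [tilde C] in its place. *)
Lemma incidence_polyI C H : H \in C ->
  (forall D, D \in minb C -> #|H :&: D| = 1%N) -> polyI R C \1_H.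
Proof.
move=> HC HD; split=> [D DC|D DC|]; last exact: nonneg_incidence.
  by rewrite dotp_incidences HD.
rewrite dotp_incidences ler1n card_gt0 finset.setIC.
by move: DC => /transversals_meets_all/meets_allP; exact.
Qed.

Lemma dotp_uniform c D : dotp [ffun=> c] \1_D = c * #|D|%:R.
Proof.
rewrite dotp_incidence (eq_bigr (fun=> c)) => [|e _]; last by rewrite ffunE.
by rewrite sumr_const mulr_natr.
Qed.

Lemma uniform_polyI C : (0 < bn C)%N -> polyI R C [ffun=> (bn C)%:R^-1].
Proof.
move=> k0; split=> [D|D DC|e]; last by rewrite ffunE invr_ge0.
  by rewrite inE dotp_uniform => /andP[_ /eqP ->]; rewrite mulVf// pnatr_eq0 -lt0n.
by rewrite dotp_uniform mulrC ler_pdivlMr ?ltr0n// mul1r ler_nat bn_le.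
Qed.

(** * Minimum transversals of [C] and of [tilde C] *)

Section IdealCovered.
Variable C : {set {set E}}.
Hypotheses (idC : ideal R C) (covC : minimum_transversal_covered C).

Lemma polyI_meets_tilde x B : polyI R C x -> meets_all (tilde C) B ->
  1 <= dotp x \1_B.
Proof.
move=> /(polyI_convex_comb idC covC)[l [l0 l1 ->]] /meets_allP BC.
rewrite dotp_suml -l1; apply: ler_sum => H HC; rewrite ler_peMr//.
by rewrite dotp_incidences ler1n card_gt0 finset.setIC BC.
Qed.

Lemma bn_le_meets_tilde B : meets_all (tilde C) B -> (bn C <= #|B|)%N.
Proof.
have [->//|k0] := posnP (bn C) => /(polyI_meets_tilde (uniform_polyI k0)).
by rewrite dotp_uniform mulrC ler_pdivlMr ?ltr0n// mul1r ler_nat.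
Qed.

Lemma minb_transversals_tilde D : D \in minb C -> D \in transversals (tilde C).
Proof.
move=> DC; rewrite inE; apply/minsetP; split=> [|B BC BD].
  apply/meets_allP => H HC.
  by rewrite finset.setIC -card_gt0 (tilde_card HC DC).
(* Minimality comes from cardinality: a subset of [D] meeting all of [tilde C] has at least
   [bn C = #|D|] elements. *)
apply/eqP; rewrite eqEcard BD /=; move: DC; rewrite inE => /andP[_ /eqP ->].
exact: bn_le_meets_tilde.
Qed.

Lemma bn_tilde D : D \in minb C -> bn (tilde C) = bn C.
Proof.
move=> DC; have Dk : #|D| = bn C by move: DC; rewrite inE => /andP[_ /eqP].
apply/eqP; rewrite eqn_leq -{1}Dk bn_le ?minb_transversals_tilde//=.
apply: bn_ge => [|B BC]; first by rewrite -Dk max_card.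
exact/bn_le_meets_tilde/transversals_meets_all.
Qed.

Lemma minb_tilde D : D \in minb C -> D \in minb (tilde C).
Proof.
move=> DC; rewrite inE minb_transversals_tilde//= (bn_tilde DC).
by move: DC; rewrite inE => /andP[].
Qed.

(* The uniform vector [1_E / k] lies in the relative interior of [I(C)], so it
   can be pushed slightly away from [1_H] without leaving [I(C)]; as
   [<_, 1_D> >= 1] on [I(C)] with equality at [1_E / k], also
   [<1_H, 1_D> <= 1]. *)
Lemma tilde_minb_tilde_card H D :
  H \in tilde C -> D \in minb (tilde C) -> #|H :&: D| = 1%N.
Proof.
move=> HC DC; have DtC : meets_all (tilde C) D.
  by move: DC; rewrite inE => /andP[/transversals_meets_all].
have HD0 : (0 < #|H :&: D|)%N.
  by rewrite card_gt0 finset.setIC; move/meets_allP: DtC; exact.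
have /card_gt0P[e _] := HD0.
have /bigcupP[D0 D0C eD0] : e \in finset.cover (minb C) by rewrite covC inE.
have Dk : #|D| = bn C.
  by move: DC; rewrite inE => /andP[_ /eqP]; rewrite (bn_tilde D0C).
set k := bn C in Dk.
have k0 : (0 < k)%N.
  move: D0C; rewrite inE /k => /andP[_ /eqP <-].
  by apply/card_gt0P; exists e.
have kR0 : 0 < k%:R :> R by rewrite ltr0n.
have k1R0 : 0 < k%:R + 1 :> R by rewrite addr_gt0.
(* With this choice [1/k - eps = eps * k]. Hence [x] below stays nonnegative, and a transversal [B]
   with at least [k + 1] elements gets at least [eps * k * #|B| >= 1], even if [H] contains [B]. *)
pose eps : R := (k%:R * (k%:R + 1))^-1.
have eps0 : 0 < eps by rewrite invr_gt0 mulr_gt0.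
have epsk : eps * k%:R * (k%:R + 1) = 1.
  by rewrite -mulrA mulVf// gt_eqF// mulr_gt0.
pose x : {ffun E -> R^o} := (1 + eps) *: [ffun=> k%:R^-1] + (- eps) *: \1_H.
have xE B : dotp x \1_B = (1 + eps) * (#|B|%:R / k%:R) - eps * #|H :&: B|%:R.
  by rewrite dotpDl dotpZl dotp_uniform dotp_incidences mulNr [_^-1 * _]mulrC.
have xI : polyI R C x.
  have invk : k%:R^-1 = eps * (k%:R + 1).
    by apply: (mulIf (lt0r_neq0 kR0)); rewrite mulVf ?gt_eqF// mulrAC epsk.
  split=> [B BC|B BC|f].
  - rewrite xE (tilde_card HC BC); move: BC; rewrite inE => /andP[_ /eqP ->].
    by rewrite divff ?gt_eqF//; ring.
  - have [BC'|] := boolP (B \in minb C).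
      rewrite xE (tilde_card HC BC'); move: BC'; rewrite inE => /andP[_ /eqP ->].
      by rewrite divff ?gt_eqF// !mulr1 addrK.
    rewrite inE BC /= eq_sym => kB.
    have {}kB : (k < #|B|)%N by rewrite ltn_neqAle kB bn_le.
    have bk : k%:R + 1 <= #|B|%:R :> R by rewrite natr1 ler_nat.
    have hb : #|H :&: B|%:R <= #|B|%:R :> R.
      by rewrite ler_nat subset_leq_card// finset.subsetIr.
    have {}hb := ler_wpM2l (ltW eps0) hb.
    have epsk0 : 0 <= eps * k%:R by rewrite mulr_ge0// ltW.
    have {}bk := ler_wpM2l epsk0 bk.
    have sq0 : 0 <= eps * eps * #|B|%:R * (k%:R + 1) by rewrite !mulr_ge0// ltW.
    by rewrite xE invk; rewrite epsk in bk; lra.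
  - rewrite !ffunE /GRing.scale /= invk; case: (f \in H) => /=; nra.
(* This reads [1 <= 1 + eps - eps * #|H :&: D|]. *)
have := polyI_meets_tilde xI DtC; rewrite xE Dk divff ?gt_eqF// mulr1.
rewrite -addrA lerDl subr_ge0 ger_pMr// lern1 => HD1.
by apply/eqP; rewrite eqn_leq HD1.
Qed.

End IdealCovered.

End Polyhedra.

(** * Convex hull and extreme points of [polyI R C] *)

Theorem theorem3p21 (R : realType) (E : finType) (C : {set {set E}})
    (hclutter : is_clutter C)
    (hideal : ideal R C)
    (hcovered : minimum_transversal_covered C) :
  [/\ integral_polytope (polyI R (tilde C)),
      polyI R C = polyI R (tilde C)
    & extreme_points (polyI R C) = [set incidence R H | H in [set` tilde C]]].
Proof.
set T := tilde C; set V := [set incidence R H | H in [set` T]].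
have polyI_V : V `<=` polyI R C.
  move=> _ [H HT <-]; apply: incidence_polyI.
    exact: fintype.subsetP (tilde_sub C) H HT.
  by move=> D; exact: tilde_card.
have polyI_T_V : V `<=` polyI R T.
  move=> _ [H HT <-]; apply: incidence_polyI => // D.
  by move=> DT; exact: (tilde_minb_tilde_card hideal hcovered HT DT).
(* Minimality of [polyI R C] among convex sets containing [V] yields the inclusion into [polyI R T],
   integrality, and the location of the extreme points. *)
have polyI_min A : @convex_set R {ffun E -> R^o} A -> V `<=` A -> polyI R C `<=` A.
  move=> cA VA x /(polyI_convex_comb hideal hcovered)[l [l0 l1 ->]].
  by apply: convex_sum => // H HT; apply: VA; exists H.
have polyI_tildeE : polyI R C = polyI R T.
  apply/seteqP; split; first exact: polyI_min (@convex_polyI _ _ _) _.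
  move=> x [xD1 xD x0]; split=> // [D DC|D DC].
    exact/xD1/(minb_tilde hideal hcovered).
  (* A transversal of [C] meets all of [T], hence contains a transversal of [T], whose inequality is
     stronger. *)
  have /transversal_sub[B BT BD] : meets_all T D.
    apply/meets_allP => H HT; have /meets_allP := transversals_meets_all DC.
    by apply; exact: fintype.subsetP (tilde_sub C) H HT.
  rewrite (le_trans (xD B BT))// !dotp_incidence [leRHS](big_setID B) /=.
  by rewrite (finset.setIidPr BD) lerDl sumr_ge0.
split=> //.
- rewrite -polyI_tildeE; split; last first.
    exists 1 => x xI e; rewrite ger0_norm; first exact: polyI_le1 xI.
    by have [_ _] := xI.
  split; first exact: is_polyhedron_polyI.
  apply/seteqP; split; last first.
    apply: smallest_sub; first exact: convex_polyI.
    by move=> x [].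
  move=> x xI A [cA iA]; apply: polyI_min cA _ x xI => _ [H HT <-].
  apply: iA; split; first by apply: polyI_V; exists H.
  by move=> e; rewrite ffunE; exact: natr_int.
- apply/seteqP; split=> [x [xI xext]|_ [H HT <-]].
    apply: contrapT => xV.
    (* Removing an extreme point keeps the set convex; if [x] were not in [V], the rest would still
       contain [V], hence all of [polyI R C]. *)
    suff : (polyI R C `\ x) x by case=> _; exact.
    apply: (polyI_min (polyI R C `\ x)) => // [|v Vv]; last first.
      by split; [exact: polyI_V|move=> vx; apply: xV; rewrite -vx].
    apply/convex_setP => y z t t01 [yI yx] [zI zx]; split.
      by move/convex_setP : (@convex_polyI R E C); exact.
    by move=> /esym /(xext _ _ _ yI zI t01)[].
  split=> [|y z t yI zI /andP[t0 t1] HE]; first by apply: polyI_V; exists H.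
  (* Coordinates lie between 0 and 1, and a proper convex combination reaches 0 or 1 only when both
     terms do. *)
  have yz e : y e = incidence R H e /\ z e = incidence R H e.
    have [[_ _ y0] [_ _ z0]] := (yI, zI).
    have y1 := polyI_le1 e hcovered yI; have z1 := polyI_le1 e hcovered zI.
    move: (congr1 (fun f : {ffun E -> R^o} => f e) HE) (y0 e) (z0 e).
    rewrite !ffunE /GRing.scale /=; case: (e \in H) => /=; split; nra.
  by split; apply/ffunP => e; have [] := yz e.
Qed.
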